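(* Let $Z$ be a regular language over $A$ which is a strong alt-induced code and a prefix code. Then there exists a regular language $M\supseteq Z$ which is a strong alt-induced code and a maximal prefix code. The same statement holds with ''prefix'' replaced throughout by ''suffix'', and with ''prefix'' replaced throughout by ''bifix''.
   Context: $A$ is a finite non-empty alphabet, $A^*$ the set of finite words, $\varepsilon$ the empty word, $A^+=A^*\setminus\{\varepsilon\}$, $XY=\{xy\mid x\in X,y\in Y\}$. A set $X\subseteq A^+$ is a prefix (suffix) code if no word of $X$ is a proper prefix (suffix) of another word of $X$, and a bifix code if it is both. A maximal prefix (suffix, bifix) code over $A$ is a prefix (suffix, bifix) code not properly contained in any other prefix (resp. suffix, bifix) code over $A$. For $w\in A^*$, $Z\subseteq A^*$: $w^{-1}Z=\{u\mid wu\in Z\}$, $Zw^{-1}=\{u\mid uw\in Z\}$, $X^{-1}Z=\bigcup_{x\in X}x^{-1}Z$, $ZY^{-1}=\bigcup_{y\in Y}Zy^{-1}$. For non-empty $X,Y\subseteq A^+$, an alternative factorization on $(X,Y)$ is a factorization $u_1\cdots u_n$, $n\ge2$, $u_i\in X\cup Y$, with $u_i\in X\Rightarrow u_{i+1}\in Y$ and $u_i\in Y\Rightarrow u_{i+1}\in X$; two such are similar if their first factors lie in the same set ($X$ or $Y$) and their last factors lie in the same set. $(X,Y)$ is an alternative code if no word of $A^+$ has two different similar alternative factorizations on $(X,Y)$; it is a strong alternative code if moreover $X^{-1}(XY)\subseteq Y$ and $(XY)Y^{-1}\subseteq X$. $Z\subseteq A^+$ is a strong alt-induced code if $Z=XY$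 for some strong alternative code $(X,Y)$. *)

(* Defs.v *)
From mathcomp Require Import all_boot.
Set Implicit Arguments. Unset Strict Implicit. Unset Printing Implicit Defensive.

Definition lang (A : finType) := seq A -> Prop.

Section Defs.
Variable A : finType.

Definition lsub (X Y : lang A) := forall w, X w -> Y w.

Definition in_Aplus (X : lang A) := forall w, X w -> w <> [::].

Definition lnonempty (X : lang A) := exists w, X w.

Definition lconcat (X Y : lang A) : lang A :=
  fun w => exists x y, X x /\ Y y /\ w = x ++ y.

Definition regular (L : lang A) : Prop :=
  exists (Q : finType) (q0 : Q) (d : Q -> A -> Q) (F : pred Q),
    forall w, L w <-> F (foldl d q0 w).

Definition prefix_code (X : lang A) : Prop :=
  in_Aplus X /\ forall u t, X u -> X (u ++ t) -> t = [::].
Definition suffix_code (X : lang A) : Prop :=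
  in_Aplus X /\ forall u t, X u -> X (t ++ u) -> t = [::].
Definition bifix_code (X : lang A) : Prop := prefix_code X /\ suffix_code X.

Definition maximal_in (P : lang A -> Prop) (X : lang A) : Prop :=
  P X /\ forall Y, P Y -> lsub X Y -> lsub Y X.

Definition maximal_prefix_code := maximal_in prefix_code.
Definition maximal_suffix_code := maximal_in suffix_code.
Definition maximal_bifix_code := maximal_in bifix_code.

Fixpoint alt_chain (X Y : lang A) (b : bool) (s : seq (seq A)) : Prop :=
  match s with
  | [::] => True
  | u :: s' => (if b then X u else Y u) /\ alt_chain X Y (~~ b) s'
  end.

(* An alternative factorization on (X,Y) is a list of n >= 2 factors with
   its alternation pattern (starting set b).  Two of them are similar iff
   they have the same starting set (same b) and the same ending set
   (same parity of length, given the same b).  (X,Y) is an alternative code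
   if two similar alternative factorizations of the same word coincide. *)
Definition alt_code (X Y : lang A) : Prop :=
  lnonempty X /\ lnonempty Y /\ in_Aplus X /\ in_Aplus Y /\
  forall (b : bool) (s1 s2 : seq (seq A)),
    2 <= size s1 -> 2 <= size s2 ->
    alt_chain X Y b s1 -> alt_chain X Y b s2 ->
    odd (size s1) = odd (size s2) ->
    flatten s1 = flatten s2 -> s1 = s2.

Definition strong_alt_code (X Y : lang A) : Prop :=
  alt_code X Y /\
  (forall x u, X x -> lconcat X Y (x ++ u) -> Y u) /\
  (forall y u, Y y -> lconcat X Y (u ++ y) -> X u).

Definition strong_alt_induced (Z : lang A) : Prop :=
  exists X Y : lang A, strong_alt_code X Y /\ forall w, Z w <-> lconcat X Y w.

End Defs.

(* Main.v *)
Require Import Defs.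
From mathcomp Require Import all_boot.
From mathcomp Require Import boolp zify.
Set Implicit Arguments. Unset Strict Implicit. Unset Printing Implicit Defensive.

(** If (X, Y) is a strong alternative code then X is a prefix code and Y a suffix
    code; conversely this suffices as soon as Y is also prefix or X also suffix.
    Hence Z = XY is prefix iff Y is bifix, and Z is completed by completing X to
    a regular maximal prefix code and Y to a regular bifix code that is also
    right complete (every word is prefix-comparable with a code word).

    The bifix completion is greedy: a word enters the code iff it has no proper
    prefix and no proper suffix in the code and is either in Y or neither a
    prefix nor a suffix of a word of Y.  Everything follows from a bound on the
    number of suffixes of a word w without prefix in the code.  This number
    never decreases and increases at a letter only if each of these suffixes
    becomes a prefix (at most |Q| of them, Y being suffix) or a suffix of a word
    of Y.  Let I(w) be the set of states of an automaton of Y reached by those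
    words zw that are prefixes of words of Y, and I'(w) the non-final ones among
    them.  Their sizes can only drop when w is extended on either side, and each
    increase is paid for by such a drop: |I'| drops when the new w is a suffix
    of Y (Y being prefix), and otherwise |I(w)| < |I(v)| for v the longest suffix
    of w which is a suffix of Y, while v has all but |Q| of the suffixes counted
    for w.  A word w that stayed open in all its extensions would make the number
    unbounded along the powers of w, so the completion is right complete; it is
    regular because the bounded list of open suffixes is a finite memory. *)

(** * Removal of one element from a list *)

Fixpoint rem_first (S : Type) (q : pred S) (l : seq S) : seq S :=
  if l is x :: l' then if q x then l' else x :: rem_first q l' else [::].

Lemma rem_first_map (S S' : Type) (q : pred S') (f : S -> S') (l : seq S) :
  rem_first q (map f l) = map f (rem_first (q \o f) l).
Proof. by elim: l => //= x l ->; case: ifP. Qed.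

Section RemFirst.
Variables (T : eqType) (p : pred T).
Implicit Types (l : seq T) (x y : T).

Lemma eq_in_rem_first (q : pred T) l :
  {in l, p =1 q} -> rem_first p l = rem_first q l.
Proof.
elim: l => //= x l IH E; rewrite E ?mem_head // IH // => y yl.
by rewrite E // inE yl orbT.
Qed.

Lemma size_rem_first l : size (rem_first p l) + has p l = size l.
Proof.
by elim: l => //= x l IH; case: (p x) => /=; rewrite ?addn1 // addSn IH.
Qed.

Lemma rem_first_rcons l x :
  rem_first p (rcons l x) =
    if has p l || ~~ p x then rcons (rem_first p l) x else rem_first p l.
Proof.
elim: l => /= [|y l ->]; first by case: (p x).
by case: (p y) => //=; case: ifP.
Qed.

Lemma mem_rem_first l x : x \in rem_first p l -> x \in l.
Proof.
elim: l => //= y l IH; case: ifP => _; rewrite !inE; first by move->; rewrite orbT.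
by case/predU1P=> [->|/IH->]; rewrite ?eqxx ?orbT.
Qed.

Lemma removed_sat l x : x \in l -> x \notin rem_first p l -> p x.
Proof.
elim: l => //= y l IH; rewrite inE; case/predU1P=> [->|xl].
  by case: ifP => //; rewrite inE eqxx.
by case: ifP => [_|_]; rewrite ?xl // inE => /norP[_]; apply: IH.
Qed.

Lemma removed_unique l x y :
  x \in l -> y \in l -> x \notin rem_first p l -> y \notin rem_first p l -> x = y.
Proof.
elim: l => //= z l IH; rewrite !inE; case: ifP => _.
  by do 2![case/predU1P=> [->|->//]].
rewrite !inE => xl yl /norP[/negPf xz xr] /norP[/negPf yz yr].
by apply: IH => //; [move: xl|move: yl]; rewrite ?xz ?yz.
Qed.

Lemma exists_removed l :
  uniq l -> has p l -> exists2 x, x \in l & x \notin rem_first p l.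
Proof.
elim: l => //= y l IH /andP[yl ul]; case: ifP => [_ _|npy /= hl].
  by exists y; rewrite ?mem_head.
have [x xl xr] := IH ul hl; exists x; rewrite inE ?xl ?orbT // negb_or xr andbT.
by apply: contraNneq yl => <-.
Qed.
End RemFirst.

(** * Frontiers, right completeness and products of languages *)

Section Frontier.
Variable A : finType.
Implicit Types (P : pred (seq A)) (X Y : lang A) (u v w x z : seq A).

(** Lets later automata be given by the finite information [h w] that they remember about the word
    read. *)
Lemma regular_run (T : finType) (h : seq A -> T) (st : T -> A -> T) (G : pred T)
    X :
  (forall w a, h (rcons w a) = st (h w) a) -> (forall w, X w <-> G (h w)) ->
  regular X.
Proof.
move=> hst hG; exists T, (h [::]), st, G => w; rewrite hG.
suff -> : foldl st (h [::]) w = h w by [].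
by elim/last_ind: w => // w a IH; rewrite foldl_rcons IH hst.
Qed.

(** For a prefix-closed [P] containing the empty word, these are the prefix-minimal words outside
    [P]. *)
Definition frontier P : lang A :=
  fun x => exists w a, [/\ x = rcons w a, P w & ~~ P x].

Definition right_complete X :=
  forall w, exists z x t, X x /\ w ++ z = x ++ t.

Definition prefix_closed P := P [::] /\ forall u v, P (u ++ v) -> P u.

(** Membership also depends on the state before the last letter, so the automaton of [P] is enlarged
    by one bit. *)
Lemma frontier_regular P : regular (fun w => P w) -> regular (frontier P).
Proof.
case=> Q [q0 [d [F HF]]].
have EF w : P w = F (foldl d q0 w).
  by apply/idP/idP => /HF.
pose h w := (foldl d q0 w, `[< frontier P w >]).
apply: (@regular_run _ h (fun s a => (d s.1 a, F s.1 && ~~ F (d s.1 a))) snd).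
- move=> w a; congr (_, _); rewrite /= ?foldl_rcons //.
  apply/asboolP/andP => [[w' [a' [/rcons_inj[<- _]]]]|[]].
    by rewrite !EF foldl_rcons.
  by exists w, a; rewrite !EF foldl_rcons.
- by move=> w; split=> [|/asboolP//] H; apply/asboolP.
Qed.

Lemma prefix_codeN X x u t : prefix_code X -> X x -> X u -> x = u ++ t -> x = u.
Proof.
by move=> [_ hX] Xx Xu e; move: Xx; rewrite e => /(hX _ _ Xu) ->; rewrite cats0.
Qed.

Lemma frontier_prefix_code P : prefix_closed P -> prefix_code (frontier P).
Proof.
move=> [P0 Pp]; split=> [x [w [a [-> _ _]]]|u t [w [a [_ _ nPu]]] [w' [a' [e Pw' _]]]].
  by case: w.
case/lastP: t e => // t b; rewrite -rcons_cat => /rcons_inj[e _].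
by move: nPu; rewrite (Pp u t) // e.
Qed.

Lemma frontier_prefix P u : P [::] -> ~~ P u ->
  exists x t, frontier P x /\ u = x ++ t.
Proof.
move=> P0; elim/last_ind: u => [|u a IH nP]; first by rewrite P0.
have [Pu|/IH[x [t [Fx ->]]]] := boolP (P u).
  by exists (rcons u a), [::]; rewrite cats0; split=> //; exists u, a.
by exists x, (rcons t a); rewrite rcons_cat.
Qed.

Lemma frontier_right_complete P :
  P [::] -> (forall w, exists z, ~~ P (w ++ z)) -> right_complete (frontier P).
Proof.
by move=> P0 H w; have [z /(frontier_prefix P0)[x [t [? ?]]]] := H w; exists z, x, t.
Qed.

Lemma prefix_code_cat_inj X x y u v :
  prefix_code X -> X x -> X y -> x ++ u = y ++ v -> x = y /\ u = v.
Proof.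
move=> pX Xx Xy e; suff exy : x = y.
  split=> //; move: e; rewrite exy => /(congr1 (drop (size y))).
  by rewrite !drop_size_cat.
have [le|/ltnW le] := leqP (size x) (size y).
  apply/esym/(prefix_codeN pX Xy Xx (t := drop (size x) y)).
  by rewrite -{1}(cat_take_drop (size x) y) -(takel_cat v le) -e take_size_cat.
apply: (prefix_codeN pX Xx Xy (t := drop (size y) x)).
by rewrite -{1}(cat_take_drop (size y) x) -(takel_cat u le) e take_size_cat.
Qed.

(** A word of a larger prefix code is prefix-comparable with a word of [X], hence equal to it. *)
Lemma right_complete_maximal X :
  prefix_code X -> right_complete X -> maximal_prefix_code X.
Proof.
move=> pX cX; split=> // Y pY XY y Yy; have [z [x [t [Xx e]]]] := cX y.
by have [-> _] := prefix_code_cat_inj pY Yy (XY _ Xx) e.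
Qed.

Lemma right_complete_lconcat X Y :
  right_complete X -> right_complete Y -> right_complete (lconcat X Y).
Proof.
move=> cX cY w; have [z [x [t [Xx e]]]] := cX w; have [z' [y [t' [Yy e']]]] := cY t.
exists (z ++ z'), (x ++ y), t'; split; first by exists x, y.
by rewrite catA e -!catA e'.
Qed.

Lemma prefix_code_lconcat X Y :
  prefix_code X -> prefix_code Y -> prefix_code (lconcat X Y).
Proof.
move=> pX pY; split=> [w [x [y [Xx [_ ->]]]]|_ t [x [y [Xx [Yy ->]]]]].
  by case: x Xx => // /(proj1 pX).
move=> [x' [y' [Xx' [Yy']]]].
rewrite -catA => /(prefix_code_cat_inj pX Xx Xx')[_ e].
by case: pY => _ /(_ y t); apply => //; rewrite e.
Qed.

Lemma regular_lconcat X Y : regular X -> regular Y -> regular (lconcat X Y).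
Proof.
case=> Q1 [q1 [d1 [F1 XE]]] [Q2 [q2 [d2 [F2 YE]]]].
(* Subset construction: [S w] collects the states of the second automaton after each remainder of
   [w] past a prefix in [X]. *)
pose S w := [set q | `[< exists x y, [/\ X x, w = x ++ y & q = foldl d2 q2 y] >]].
pose h w := (foldl d1 q1 w, S w).
pose st (m : Q1 * {set Q2}) a := (d1 m.1 a,
  (d2^~ a @: m.2) :|: (if F1 (d1 m.1 a) then [set q2] else set0)).
apply: (@regular_run _ h st (fun m => [exists q in m.2, F2 q])) => w.
  move=> a; rewrite /h /st /= foldl_rcons; congr (_, _).
  have -> : d1 (foldl d1 q1 w) a = foldl d1 q1 (rcons w a) by rewrite foldl_rcons.
  apply/setP => q; rewrite inE [in RHS]inE; apply/asboolP/orP.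
    move=> [x [y [Xx e ->]]]; case/lastP: y e => [|y b].
      rewrite cats0 => e; right; rewrite e.
      by have /XE -> := Xx; rewrite inE.
    rewrite -rcons_cat foldl_rcons => /rcons_inj[-> ->]; left; apply/imsetP.
    by exists (foldl d2 q2 y) => //; rewrite inE; apply/asboolP; exists x, y.
  case=> [/imsetP[p]|].
    rewrite inE => /asboolP[x [y [Xx -> ->]]] ->; exists x, (rcons y a).
    by rewrite rcons_cat foldl_rcons.
  case: ifP => [/XE Xw|_]; rewrite inE // => /eqP->.
  by exists (rcons w a), [::]; rewrite cats0.
split=> [[x [y [Xx [/YE Fy ->]]]]|/existsP[q /andP[]]].
  apply/existsP; exists (foldl d2 q2 y); rewrite Fy andbT inE.
  by apply/asboolP; exists x, y.
by rewrite inE => /asboolP[x [y [Xx -> ->]]] /YE; exists x, y.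
Qed.

(** * Reversal, exchanging prefix and suffix codes *)

Definition revl X : lang A := fun w => X (rev w).

Lemma prefix_code_revl X : prefix_code (revl X) <-> suffix_code X.
Proof.
split=> -[X0 pX]; split=> [w Xw|u t Xu Xt].
- by move=> e; case: (X0 (rev w)); rewrite /revl ?revK // e.
- by rewrite -[t]revK (pX (rev u) (rev t)) // /revl -?rev_cat revK.
- by move=> e; apply: (X0 _ Xw); rewrite e.
- by rewrite -[t]revK (pX (rev u) (rev t)) // -rev_cat.
Qed.

Lemma suffix_code_revl X : suffix_code (revl X) <-> prefix_code X.
Proof.
rewrite -prefix_code_revl; have -> // : revl (revl X) = X.
by apply: funext => w; rewrite /revl revK.
Qed.

Lemma bifix_code_revl X : bifix_code X -> bifix_code (revl X).
Proof. by move=> [? ?]; split; [apply/prefix_code_revl|apply/suffix_code_revl]. Qed.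

(** The memory is the transition map of the reversed word; a new letter acts before it, so it is
    composed on the inside. *)
Lemma regular_revl X : regular X -> regular (revl X).
Proof.
move=> [Q [q0 [d [F XE]]]].
apply: (@regular_run {ffun Q -> Q} (fun w => [ffun q => foldl d q (rev w)])
  (fun m a => [ffun q => m (d q a)]) (fun m => F (m q0))) => w.
  by move=> a; apply/ffunP => q; rewrite !ffunE rev_rcons.
by rewrite /revl XE ffunE.
Qed.

Lemma revl_lconcat X Y w : revl (lconcat X Y) w <-> lconcat (revl Y) (revl X) w.
Proof.
split=> [[x [y [Xx [Yy e]]]]|[y [x [Yy [Xx ->]]]]].
  exists (rev y), (rev x); rewrite /revl !revK; split=> //; split=> //.
  by rewrite -rev_cat -e revK.
by exists (rev x), (rev y); rewrite rev_cat.
Qed.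

Lemma suffix_code_cat_inj X x y u v :
  suffix_code X -> X x -> X y -> u ++ x = v ++ y -> x = y /\ u = v.
Proof.
move=> /(proj2 (prefix_code_revl _)) pX Xx Xy /(congr1 rev); rewrite !rev_cat.
case/(prefix_code_cat_inj pX _ _) => [||/(can_inj revK) ? /(can_inj revK)] //;
by rewrite /revl revK.
Qed.

Lemma suffix_code_lconcat X Y :
  suffix_code X -> suffix_code Y -> suffix_code (lconcat X Y).
Proof.
move=> /(proj2 (prefix_code_revl _)) pX /(proj2 (prefix_code_revl _)) pY.
apply/prefix_code_revl.
have -> : revl (lconcat X Y) = lconcat (revl Y) (revl X).
  by apply: funext => w; apply/propext/revl_lconcat.
exact: prefix_code_lconcat.
Qed.
End Frontier.

(** * The greedy bifix code of a predicate *)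

Section Greedy.
Variables (A : finType) (ok : pred (seq A)).
Implicit Types (s t u v w x : seq A).

(* [opens w] lists the suffixes of [w] without prefix in the code, shortest
   first; reading a letter puts into the code the shortest extension allowed by
   [ok]. *)
Definition opens w : seq (seq A) :=
  foldl (fun l a => [::] :: rem_first ok [seq rcons s a | s <- l]) [:: [::]] w.

Definition is_open w := w \in opens w.
Definition greedy := frontier is_open.

Lemma opens_rcons w a :
  opens (rcons w a) = [::] :: rem_first ok [seq rcons s a | s <- opens w].
Proof. exact: foldl_rcons. Qed.

(** The list runs from short to long and only the first admissible extension leaves it, so the
    longest entry, the whole word, cannot influence the others. *)
Lemma opens_cons a w :
  opens (a :: w) = opens w \/ opens (a :: w) = rcons (opens w) (a :: w).
Proof.
elim/last_ind: w => [|w b IH]; first by rewrite /opens /=; case: ifP; [left|right].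
rewrite -rcons_cons !opens_rcons; case: IH => ->; first by left.
rewrite map_rcons rem_first_rcons; case: ifP => _; last by left.
by right.
Qed.

Lemma opens_suffix w s : s \in opens w -> suffix s w.
Proof.
elim: w => [|a w IH]; first by rewrite inE => /eqP->.
case: (opens_cons a w) => -> => [/IH|]; first exact: (@suffix_catr _ _ _ [:: a]).
rewrite mem_rcons inE => /predU1P[->|/IH]; first exact: suffix_refl.
exact: (@suffix_catr _ _ _ [:: a]).
Qed.

Lemma opens_is_open w s : s \in opens w -> is_open s.
Proof.
elim: w => [|a w IH]; first by rewrite inE => /eqP->.
case E: (opens_cons a w) => [e|e]; rewrite e // mem_rcons inE => /predU1P[->|/IH//].
by rewrite /is_open e mem_rcons mem_head.
Qed.

Lemma opens_catr v s w : s \in opens w -> s \in opens (v ++ w).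
Proof.
elim: v => //= a v IH /IH sw.
by case: (opens_cons a (v ++ w)) => ->; rewrite // mem_rcons inE sw orbT.
Qed.

Lemma mem_opens w s : (s \in opens w) = suffix s w && is_open s.
Proof.
apply/idP/andP => [sw|[/suffixP[v ->]]]; last exact: opens_catr.
by rewrite opens_suffix // (opens_is_open sw).
Qed.

Lemma opens_uniq w : uniq (opens w).
Proof.
elim: w => // a w IH; case: (opens_cons a w) => -> //.
rewrite rcons_uniq IH andbT; apply/negP => /opens_suffix/size_suffix /=.
by rewrite ltnn.
Qed.

Lemma is_open0 : is_open [::]. Proof. by []. Qed.

Lemma mem_opens_rcons w a s :
  rcons s a \in opens (rcons w a) ->
  (s \in opens w) && (rcons s a \in rem_first ok [seq rcons s a | s <- opens w]).
Proof.
rewrite opens_rcons inE; case/predU1P => [|H]; first by case: s.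
by rewrite H andbT; have /mapP[s' sw /rcons_inj[->]] := mem_rem_first H.
Qed.

Lemma is_open_prefix_closed : prefix_closed is_open.
Proof.
split=> [|u v]; first exact: is_open0.
elim/last_ind: v => [|v a IH]; rewrite ?cats0 // -rcons_cat.
by move/mem_opens_rcons/andP=> [/IH].
Qed.

(* The suffixes leaving the list of open suffixes at a given letter are the
   code words ending there. *)
Lemma greedy_removed w a s : s \in opens w ->
  (rcons s a \notin rem_first ok [seq rcons s a | s <- opens w]) <->
  greedy (rcons s a).
Proof.
move=> sw; split=> [H|[? [? [_ _ nP]]]].
  exists s, a; split=> //; first exact: opens_is_open sw.
  apply: contraNN H => P.
  suff /mem_opens_rcons/andP[] : rcons s a \in opens (rcons w a) by [].
  by rewrite mem_opens P suffix_rcons eqxx opens_suffix.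
apply: contraNN nP => H; apply: (@opens_is_open (rcons w a)).
by rewrite opens_rcons inE H orbT.
Qed.

Lemma greedy_ok x : greedy x -> ok x.
Proof.
move=> Gx; case: (Gx) => w [a [e Pw _]]; rewrite e.
apply: (@removed_sat _ _ [seq rcons s a | s <- opens w]); first exact: map_f.
by apply/greedy_removed => //; rewrite -e.
Qed.

Lemma greedy_prefix_code : prefix_code greedy.
Proof. exact/frontier_prefix_code/is_open_prefix_closed. Qed.

(** Two code words ending at the same place would both leave the list of open suffixes at their last
    letter, but only one element leaves. *)
Lemma greedy_suffix_code : suffix_code greedy.
Proof.
split=> [|u t Gu Gtu]; first by case: greedy_prefix_code.
case: (Gu) (Gtu) => w [a [e Pw _]] [w' [a' [e' Pw' _]]].
move: e'; rewrite e -rcons_cat => /rcons_inj[e' _].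
have wo : w \in opens (t ++ w) by rewrite mem_opens suffix_suffix.
have tw : t ++ w \in opens (t ++ w) by rewrite e'.
pose l := [seq rcons s a | s <- opens (t ++ w)].
have removed s : s \in opens (t ++ w) -> greedy (rcons s a) ->
    rcons s a \in l /\ rcons s a \notin rem_first ok l.
  by move=> so Gs; split; [apply: map_f|apply/greedy_removed].
have [|wl wr] := removed w wo; first by rewrite -e.
have [|twl twr] := removed (t ++ w) tw; first by rewrite rcons_cat -e.
have /(congr1 size) := removed_unique wl twl wr twr.
rewrite !size_rcons size_cat.
by case: t {Gtu e' wo tw l removed wl wr twl twr} => //= ? ?; lia.
Qed.

Lemma greedy_suffix w a : is_open w -> ok (rcons w a) ->
  exists2 x, greedy x & suffix x (rcons w a).
Proof.
move=> Pw okw; pose l := [seq rcons s a | s <- opens w].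
have ul : uniq l by rewrite map_inj_uniq ?opens_uniq // => ? ? /rcons_inj[].
have hl : has ok l by apply/hasP; exists (rcons w a) => //; apply: map_f.
have [_ /mapP[s sw ->] H] := exists_removed ul hl.
exists (rcons s a); first by apply/(greedy_removed _ sw).
by rewrite suffix_rcons eqxx opens_suffix.
Qed.

Lemma size_opens_rcons w a :
  size (opens (rcons w a)) =
    (size (opens w)).+1 - has ok [seq rcons s a | s <- opens w].
Proof.
rewrite opens_rcons /=.
have := size_rem_first ok [seq rcons s a | s <- opens w].
by rewrite size_map => <-; rewrite -addSn addnK.
Qed.

Lemma size_opens_cat u v : u <> [::] -> is_open (u ++ v) ->
  size (opens v) < size (opens (u ++ v)).
Proof.
move=> u0 Puv; apply: (@uniq_leq_size _ ((u ++ v) :: opens v)).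
  rewrite /= opens_uniq andbT; apply/negP => /opens_suffix/size_suffix.
  by rewrite size_cat; case: u u0 {Puv} => //= ? ? _; lia.
by move=> x; rewrite inE => /predU1P[->|/opens_catr].
Qed.

(** If all extensions of [w] were open, so would be all its powers, and each further factor [w] adds
    an open suffix. *)
Lemma bounded_opens_closable B w :
  (forall u, size (opens u) <= B) -> w <> [::] -> exists z, ~~ is_open (w ++ z).
Proof.
move=> HB w0; apply: contrapT => H.
have Pw z : is_open (w ++ z) by apply/negP => N; apply: H; exists z; apply/negP.
have lt k : k < size (opens (iter k (cat w) [::])).
  by elim: k => //= k IH; apply: leq_ltn_trans IH (size_opens_cat w0 (Pw _)).
by have := leq_trans (lt B) (HB _); rewrite ltnn.
Qed.
End Greedy.

(** * The greedy completion of a regular bifix code *)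

Section Completion.
Variables (A Q : finType) (q0 : Q) (d : Q -> A -> Q) (F : pred Q) (Y : lang A).
Hypothesis YE : forall w, Y w <-> F (foldl d q0 w).
Hypothesis (pY : prefix_code Y) (sY : suffix_code Y) (neY : lnonempty Y).
Implicit Types (s t u v w x : seq A).

Definition inY x := F (foldl d q0 x).
Definition left_factor x := `[< exists t, Y (x ++ t) >].
Definition right_factor x := `[< exists t, Y (t ++ x) >].
Definition compatible x := inY x || ~~ (left_factor x || right_factor x).

Lemma inYP x : reflect (Y x) (inY x).
Proof. by apply: (iffP idP) => /YE. Qed.

(** By the choice of [compatible], a code word that is a prefix or suffix of a word of [Y] lies in
    [Y]. Hence no proper prefix of a word [y] of [Y] is a code word, and the code word that ends [y]
    is [y] itself. *)
Lemma greedy_extends : lsub Y (greedy compatible).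
Proof.
have nY x : greedy compatible x -> left_factor x || right_factor x -> Y x.
  by move=> /greedy_ok /orP[/inYP//|/negPf->].
move=> y; case/lastP: y => [|w a] Yy; first by case: pY => /(_ _ Yy).
have Pw : is_open compatible w.
  apply: contrapT => /negP/(frontier_prefix (is_open0 _))[x [t [Gx e]]].
  have e' : rcons w a = x ++ rcons t a by rewrite e rcons_cat.
  have Yx : Y x.
    by apply: nY => //; apply/orP; left; apply/asboolP; exists (rcons t a); rewrite -e'.
  by move: (congr1 size (prefix_codeN pY Yy Yx e')); rewrite e' size_cat size_rcons; lia.
have [|x Gx /suffixP[t e]] := @greedy_suffix _ compatible w a Pw.
  by apply/orP; left; apply/inYP.
have Yx : Y x.
  by apply: nY => //; apply/orP; right; apply/asboolP; exists t; rewrite -e.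
suff t0 : t = [::] by rewrite e t0.
by case: sY => _; apply; first exact: Yx; rewrite -e.
Qed.

(* Two suffixes of one word reaching the same state from [q0] would be
   completed to [Y] by the same word, against [Y] being a suffix code. *)
Lemma count_left_factors w : count left_factor (opens compatible w) <= #|Q|.
Proof.
rewrite -size_filter; set l := filter _ _.
have inj : {in l &, injective (foldl d q0)}.
  have H u v : left_factor u -> suffix u v -> foldl d q0 u = foldl d q0 v -> u = v.
    move=> /asboolP[z Yz] /suffixP[s ->] e.
    have -> // : s = [::].
    case: sY => _; apply; first exact: Yz.
    by apply/YE; rewrite catA foldl_cat -e -foldl_cat; apply/YE.
  have total u v : suffix u w -> suffix v w -> size u <= size v -> suffix u v.
    move=> + + le; rewrite ![suffix _ w]suffixE => /eqP eu /eqP ev; rewrite -{1}eu -{1}ev.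
    rewrite -[size w - size u](@subnK (size w - size v)) ?leq_sub2l //.
    by rewrite -drop_drop suffix_drop.
  move=> u v; rewrite !mem_filter.
  move=> /andP[lu /opens_suffix su] /andP[lv /opens_suffix sv] e.
  have [le|/ltnW le] := leqP (size u) (size v); first by apply: H => //; apply: total.
  by apply/esym/H => //; apply: total.
rewrite -(size_map (foldl d q0)) -(card_uniqP _) ?max_card //.
by rewrite map_inj_in_uniq // filter_uniq // opens_uniq.
Qed.

Definition live u : {set Q} :=
  [set q | `[< exists z, q = foldl d q0 (z ++ u) /\ left_factor (z ++ u) >]].
(** The sum of the sizes of I and I', so that a single quantity pays for both kinds of increase. *)
Definition potential u := #|live u| + #|[set q in live u | ~~ F q]|.

Lemma liveP u q :
  reflect (exists z, q = foldl d q0 (z ++ u) /\ left_factor (z ++ u)) (q \in live u).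
Proof. by rewrite inE; apply: asboolP. Qed.

Lemma live_catl v u : live (v ++ u) \subset live u.
Proof.
apply/subsetP => q /liveP[z [-> H]]; apply/liveP; exists (z ++ v).
by rewrite -catA.
Qed.

Lemma live_catl_nonfinal v u :
  [set q in live (v ++ u) | ~~ F q] \subset [set q in live u | ~~ F q].
Proof.
apply/subsetP => q; rewrite in_set => /andP[ql nF]; rewrite in_set nF andbT.
exact: (subsetP (live_catl v u)).
Qed.

(** The state before the letter [a] is live for [u], and it is not final because [Y] is a prefix
    code. *)
Lemma card_live_rcons u a : #|live (rcons u a)| <= #|[set q in live u | ~~ F q]|.
Proof.
apply: leq_trans (leq_imset_card (d^~ a) _); apply/subset_leq_card/subsetP => q.
case/liveP=> z [-> /asboolP[t Yt]]; rewrite -rcons_cat foldl_rcons.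
apply/imsetP; exists (foldl d q0 (z ++ u)) => //; rewrite inE.
have Y2 : Y ((z ++ u) ++ a :: t) by move: Yt; rewrite -rcons_cat cat_rcons.
apply/andP; split.
  by apply/liveP; exists z; split=> //; apply/asboolP; exists (a :: t).
by apply/negP => /YE Yzu; case: pY => _ /(_ _ _ Yzu Y2).
Qed.

Lemma right_factor_live u : right_factor u = [exists q, (q \in live u) && F q].
Proof.
apply/asboolP/existsP => [[t Yt]|[q /andP[/liveP[z [-> _]] /YE]]]; last by exists z.
exists (foldl d q0 (t ++ u)); apply/andP; split; last exact/YE.
by apply/liveP; exists t; split=> //; apply/asboolP; exists [::]; rewrite cats0.
Qed.

Lemma right_factor_card u :
  right_factor u -> #|[set q in live u | ~~ F q]| < #|live u|.
Proof.
rewrite right_factor_live => /existsP[q /andP[ql Fq]].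
apply/proper_card/properP; split; first by apply/subsetP => p; rewrite inE => /andP[].
by exists q => //; rewrite in_set Fq andbF.
Qed.

Lemma card_nonfinal u : #|[set q in live u | ~~ F q]| <= #|live u|.
Proof. by apply/subset_leq_card/subsetP => p; rewrite inE => /andP[]. Qed.

(** |I'(ua)| <= |I(ua)| <= |I'(u)| <= |I(u)|, and the first inequality is strict if ua is a suffix
    of a word of [Y]. *)
Lemma potential_rcons u a : potential (rcons u a) + right_factor (rcons u a) <=
  potential u.
Proof.
have := card_live_rcons u a; have := card_nonfinal u; have := card_nonfinal (rcons u a).
rewrite /potential; have [/right_factor_card|_] := boolP (right_factor _); lia.
Qed.

(** A final live state of [u] is lost, as [v ++ u] has none. *)
Lemma potential_catl v u : right_factor u -> ~~ right_factor (v ++ u) ->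
  potential (v ++ u) < potential u.
Proof.
rewrite !right_factor_live => /existsP[q /andP[ql Fq]] /existsPn nF.
rewrite /potential -addSn leq_add ?subset_leq_card ?live_catl_nonfinal //.
apply/proper_card/properP; split; first exact: live_catl.
by exists q => //; apply/negP => ql'; move: (nF q); rewrite ql' Fq.
Qed.

Lemma potential_le u : potential u <= 2 * #|Q|.
Proof. by rewrite /potential mul2n -addnn leq_add // max_card. Qed.

Lemma right_factor0 : right_factor [::].
Proof. by case: neY => y Yy; apply/asboolP; exists y; rewrite cats0. Qed.

(** One unit of potential pays for [#|Q|] open suffixes. The constant covers the largest potential,
    [2 * #|Q|], and the one open suffix of the empty word. The induction on length is strong because
    the last case goes back to a suffix of the word. *)
Lemma opens_bound w :
  size (opens compatible w) + potential w * #|Q| <= (2 * #|Q|).+1 * #|Q|.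
Proof.
have Q1 : 0 < #|Q| by apply/card_gt0P; exists q0.
have mulQ m n k : m + k <= n -> m * #|Q| + k * #|Q| <= n * #|Q|.
  by rewrite -mulnDl leq_mul2r => ->; rewrite orbT.
have [n] := ubnP (size w); elim: n w => // n IH w.
case/lastP: w => [_|w a].
  have := leq_mul (potential_le [::]) (leqnn #|Q|).
  rewrite -[size (opens _ _)]/1 mulSn; lia.
rewrite size_rcons ltnS => szw.
have IHw := IH w szw; have := potential_rcons w a.
(* If a code word ends at [a], the number of open suffixes stays the same. *)
rewrite size_opens_rcons; case hok: (has _ _) => pw.
  have := leq_mul (leq_trans (leq_addr _ _) pw) (leqnn #|Q|); lia.
case/boolP: (right_factor _) pw => [_|nr _].
  (* One more open suffix, paid for by a drop of the potential since [#|Q|] is positive. *)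
  move=> /mulQ; lia.
(* [v] below is the longest suffix of [rcons w a] that is a suffix of a word of [Y]. *)
have exv : exists k, right_factor (drop k (rcons w a)).
  by exists (size (rcons w a)); rewrite drop_size right_factor0.
case: (ex_minnP exv) => k rk mink.
have k0 : 0 < k by case: k rk {mink} => //; rewrite drop0 (negPf nr).
set v := drop k _ in rk.
have e : take k (rcons w a) ++ v = rcons w a by rewrite cat_take_drop.
have szv : size v < n by rewrite size_drop size_rcons; lia.
have IHv := IH v szv.
have pv : potential (rcons w a) + 1 <= potential v.
  by rewrite addn1 -e potential_catl // e.
(* No extension is compatible, so each open suffix is either a left factor, and there are at most
   [#|Q|] of these, or a right factor and thus a suffix of [v]. *)
have split_opens : size (opens compatible (rcons w a)) <=
    #|Q| + size (opens compatible v).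
  rewrite -(count_predC left_factor) leq_add ?count_left_factors //.
  rewrite -size_filter uniq_leq_size ?filter_uniq ?opens_uniq // => t.
  rewrite mem_filter => /andP[/= nl to].
  have rt : right_factor t.
    move: to; rewrite opens_rcons inE => /predU1P[->|/mem_rem_first tm].
      exact: right_factor0.
    by move/hasPn: hok => /(_ _ tm); rewrite negb_or negbK (negPf nl) => /andP[].
  rewrite mem_opens (opens_is_open to) andbT.
  move/opens_suffix: to; rewrite suffixE => /eqP et; rewrite -et in rt *.
  by rewrite -[_ - size t](subnK (mink _ rt)) -drop_drop suffix_drop.
have := mulQ _ _ _ pv; rewrite size_opens_rcons hok in split_opens *; lia.
Qed.

Lemma size_opens w : size (opens compatible w) <= (2 * #|Q|).+1 * #|Q|.
Proof. exact: leq_trans (leq_addr _ _) (opens_bound w). Qed.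

Lemma greedy_right_complete : right_complete (greedy compatible).
Proof.
apply: frontier_right_complete => [|[|a w]]; first exact: is_open0.
  (* The powers of the empty word do not grow, so a word of [Y] serves as its closed extension. *)
  by have [y /greedy_extends[? [? []]]] := neY; exists y.
by apply: bounded_opens_closable size_opens _.
Qed.

(* An open suffix [s] of [w] is remembered by the map it induces on the states
   and by whether it is the whole of [w]. *)
Definition action s : {ffun Q -> Q} := [ffun q => foldl d q s].
Definition marked w := [seq (action s, s == w) | s <- opens compatible w].
(** Being a right factor depends on the images of all reachable states, which is why the whole
    action is stored and not only the state reached from [q0]. *)
Definition mark_compatible (m : {ffun Q -> Q} * bool) :=
  F (m.1 q0) || ~~ (`[< exists t, F (foldl d (m.1 q0) t) >] ||
                    `[< exists t, F (m.1 (foldl d q0 t)) >]).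
Definition read_mark a (m : {ffun Q -> Q} * bool) : {ffun Q -> Q} * bool :=
  ([ffun q => d (m.1 q) a], m.2).

Lemma mark_compatibleE s b : mark_compatible (action s, b) = compatible s.
Proof.
rewrite /mark_compatible /compatible /inY /= ffunE; congr (_ || ~~ (_ || _)).
  by apply: asbool_equiv_eq; split=> -[t H]; exists t; move: H;
    rewrite YE foldl_cat.
by apply: asbool_equiv_eq; split=> -[t H]; exists t; move: H;
  rewrite YE foldl_cat ffunE.
Qed.

Lemma marked_rcons w a :
  marked (rcons w a) =
    (action [::], false) :: rem_first mark_compatible (map (read_mark a) (marked w)).
Proof.
rewrite /marked opens_rcons /=; congr (_ :: _); first by case: w.
pose f s := (action s, s == rcons w a).
have -> : map (read_mark a) (marked w) = map f [seq rcons s a | s <- opens compatible w].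
  rewrite -!map_comp; apply: eq_map => s; rewrite /f /read_mark /= eqseq_rcons eqxx andbT.
  by congr (_, _); apply/ffunP => q; rewrite !ffunE foldl_rcons.
rewrite (rem_first_map _ f); apply: (congr1 (map f)); apply: eq_in_rem_first => s _.
by rewrite /= mark_compatibleE.
Qed.

Lemma is_open_marked w : is_open compatible w = has snd (marked w).
Proof.
rewrite /marked has_map; apply/idP/hasP => [Pw|[s sw /eqP <-]]; first by exists w => /=.
exact: opens_is_open sw.
Qed.

Lemma greedy_regular : regular (greedy compatible).
Proof.
apply: frontier_regular; pose B := (2 * #|Q|).+1 * #|Q|.
(* Lists longer than [B] would be replaced by a default value; [size_opens] excludes this. *)
have insubE w : insub_bseq B (marked w) = marked w :> seq _.
  by apply: insubdK; rewrite unfold_in size_map size_opens.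
apply: (@regular_run _ _ (fun w => insub_bseq B (marked w))
  (fun m a => insub_bseq B
     ((action [::], false) :: rem_first mark_compatible (map (read_mark a) m)))
  (fun m => has snd m)) => w.
  by move=> a; rewrite insubE marked_rcons.
by rewrite insubE is_open_marked.
Qed.
End Completion.

(** * Right complete extensions of regular bifix and prefix codes *)

Lemma bifix_completion (A : finType) (Y : lang A) :
  regular Y -> bifix_code Y -> lnonempty Y ->
  exists Y' : lang A, [/\ lsub Y Y', regular Y', bifix_code Y' & right_complete Y'].
Proof.
move=> [Q [q0 [d [F YE]]]] [pY sY] neY; exists (greedy (compatible q0 d F Y)).
split; [exact: greedy_extends|exact: greedy_regular| |exact: greedy_right_complete].
by split; [exact: greedy_prefix_code|exact: greedy_suffix_code].
Qed.

(** Here [P] consists of the proper prefixes of words of [X]. Words of [X] are outside [P], and each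
    word of [P] extends to one of them, so the frontier of [P] contains [X] and is right
    complete. *)
Lemma prefix_completion (A : finType) (X : lang A) :
  regular X -> prefix_code X -> lnonempty X ->
  exists X' : lang A, [/\ lsub X X', regular X', prefix_code X' & right_complete X'].
Proof.
move=> [Q [q0 [d [F XE]]]] [X0 pX] [x Xx].
pose P w := `[< exists a t, X (w ++ a :: t) >].
have P0 : P [::].
  by apply/asboolP; case: x Xx => [/X0//|a t]; exists a, t.
have Pp : prefix_closed P.
  split=> // u [|b v]; first by rewrite cats0.
  by move=> /asboolP[a [t H]]; apply/asboolP; exists b, (v ++ a :: t); rewrite -catA in H.
have nP y : X y -> ~~ P y by move=> Xy; apply/asboolP => -[a [t /(pX _ _ Xy)]].
exists (frontier P); split.
- move=> y; case/lastP: y => [/X0//|w a] Xwa; exists w, a; split=> //; last exact: nP.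
  by apply/asboolP; exists a, [::]; rewrite cats1.
- apply: frontier_regular; pose G q := `[< exists a t, F (foldl d q (a :: t)) >].
  exists Q, q0, d, G => w; split=> /asboolP[a [t H]]; apply/asboolP; exists a, t.
    by rewrite -foldl_cat; apply/XE.
  by apply/XE; rewrite foldl_cat.
- exact: frontier_prefix_code.
- apply: frontier_right_complete => // w.
  have [/asboolP[a [t Xw]]|nPw] := boolP (P w); last by exists [::]; rewrite cats0.
  by exists (a :: t); apply: nP.
Qed.

(** * Strong alternative codes in terms of prefix and suffix codes *)

Section Alternation.
Variable A : finType.
Implicit Types (X Y Z : lang A).

(** If x and xt are in [X] and y is in [Y], the quotient condition puts ty in [Y], so (xt)(y) =
    (x)(ty) are two similar factorizations. *)
Lemma strong_alt_prefix X Y : strong_alt_code X Y -> prefix_code X.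
Proof.
move=> [[_ [[y Yy] [X0 [_ uniq_fact]]]] [quotY _]]; split=> // x t Xx Xxt.
have Yty : Y (t ++ y).
  by apply: (quotY x) => //; exists (x ++ t), y; rewrite catA.
have [e _] : [:: x ++ t; y] = [:: x; t ++ y].
  by apply: (uniq_fact true) => //=; rewrite !cats0 catA.
by move/(congr1 size): e; rewrite size_cat; case: t {Xxt Yty} => //= ? ?; lia.
Qed.

Lemma strong_alt_suffix X Y : strong_alt_code X Y -> suffix_code Y.
Proof.
move=> [[[x Xx] [_ [_ [Y0 uniq_fact]]]] [_ quotX]]; split=> // y t Yy Yty.
have Xxt : X (x ++ t).
  by apply: (quotX y) => //; exists x, (t ++ y); rewrite catA.
have [e _] : [:: x ++ t; y] = [:: x; t ++ y].
  by apply: (uniq_fact true) => //=; rewrite !cats0 catA.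
by move/(congr1 size): e; rewrite size_cat; case: t {Yty Xxt} => //= ? ?; lia.
Qed.

Lemma lconcat_prefix_r X Y :
  lnonempty X -> in_Aplus Y -> prefix_code (lconcat X Y) -> prefix_code Y.
Proof.
move=> [x Xx] Y0 [_ pZ]; split=> // y t Yy Yyt.
apply: (pZ (x ++ y)); first by exists x, y.
by exists x, (y ++ t); rewrite catA.
Qed.

Lemma lconcat_suffix_l X Y :
  lnonempty Y -> in_Aplus X -> suffix_code (lconcat X Y) -> suffix_code X.
Proof.
move=> [y Yy] X0 [_ sZ]; split=> // x t Xx Xtx.
apply: (sZ (x ++ y)); first by exists x, y.
by exists (t ++ x), y; rewrite catA.
Qed.

Lemma alt_chain_prefix_inj X Y b s1 s2 :
  prefix_code X -> prefix_code Y -> alt_chain X Y b s1 -> alt_chain X Y b s2 ->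
  flatten s1 = flatten s2 -> s1 = s2.
Proof.
move=> pX pY; have nonempty c : ~ (if c then X [::] else Y [::]).
  by case: c => [/(proj1 pX)|/(proj1 pY)].
elim: s1 b s2 => [|u s1 IH] b [|v s2] //=.
- by move=> _ [Xv _]; case: v Xv => [/nonempty|].
- by move=> [Xu _]; case: u Xu => [/nonempty|].
move=> [Xu c1] [Xv c2] e.
suff [-> /(IH _ _ c1 c2)->//] : u = v /\ flatten s1 = flatten s2.
case: b Xu Xv {c1 c2} => Xu Xv; first exact: (prefix_code_cat_inj pX).
exact: (prefix_code_cat_inj pY).
Qed.

Lemma alt_chain_rcons X Y b s u :
  alt_chain X Y b (rcons s u) <->
  alt_chain X Y b s /\ (if b (+) odd (size s) then X u else Y u).
Proof.
elim: s b => [|v s IH] b /=; first by rewrite addbF; tauto.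
by rewrite IH addNb addbN; tauto.
Qed.

(** Decoding from the right: with a common starting set, equal parity of the lengths puts the last
    factors in the same set. *)
Lemma alt_chain_suffix_inj X Y b s1 s2 :
  suffix_code X -> suffix_code Y -> alt_chain X Y b s1 -> alt_chain X Y b s2 ->
  odd (size s1) = odd (size s2) -> flatten s1 = flatten s2 -> s1 = s2.
Proof.
move=> sX sY; have nonempty c : ~ (if c then X [::] else Y [::]).
  by case: c => [/(proj1 sX)|/(proj1 sY)].
elim/last_ind: s1 s2 => [|s1 u IH] s2; case/lastP: s2 => [|s2 v] //.
- move=> _ /alt_chain_rcons[_ Xv] _; rewrite flatten_rcons => /esym/(congr1 size).
  by rewrite size_cat; case: v Xv => [/nonempty|? ?] //=; lia.
- move=> /alt_chain_rcons[_ Xu] _ _; rewrite flatten_rcons => /(congr1 size).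
  by rewrite size_cat; case: u Xu => [/nonempty|? ?] //=; lia.
move=> /alt_chain_rcons[c1 Xu] /alt_chain_rcons[c2 Xv].
rewrite !size_rcons /= !flatten_rcons => /(can_inj negbK) odd12 e.
suff [-> /(IH _ c1 c2 odd12)->//] : u = v /\ flatten s1 = flatten s2.
move: Xu Xv; rewrite odd12; case: ifP => _ Xu Xv.
  exact: (suffix_code_cat_inj sX).
exact: (suffix_code_cat_inj sY).
Qed.

(** Factorizations are decoded from the left if both codes are prefix and from the right if both are
    suffix; the quotient conditions are cancellation in [X] on the left and in [Y] on the right. *)
Lemma strong_altI X Y :
  lnonempty X -> lnonempty Y -> prefix_code X -> suffix_code Y ->
  prefix_code Y \/ suffix_code X -> strong_alt_code X Y.
Proof.
move=> neX neY pX sY XY; split; [|split].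
- split=> //; split=> //; split; first by case: pX.
  split; first by case: sY.
  move=> b s1 s2 _ _ c1 c2 par; case: XY => [pY|sX].
    exact: (alt_chain_prefix_inj pX pY c1 c2).
  exact: (alt_chain_suffix_inj sX sY c1 c2).
- by move=> x u Xx [x' [y [Xx' [Yy /(prefix_code_cat_inj pX Xx Xx')[_ ->]]]]].
- by move=> y u Yy [x [y' [Xx [Yy' /(suffix_code_cat_inj sY Yy Yy')[_ ->]]]]].
Qed.

(** For fixed x in [X] and y in [Y] the quotient conditions give X = Zy^{-1} and Y = x^{-1}Z, where
    Z = XY; only the final states or the initial state of the automaton change. *)
Lemma regular_factors X Y : strong_alt_code X Y -> regular (lconcat X Y) ->
  regular X /\ regular Y.
Proof.
move=> [[[x Xx] [[y Yy] _]] [quotY quotX]] [Q [q0 [d [F ZE]]]]; split.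
  exists Q, q0, d, (fun q => F (foldl d q y)) => w; rewrite -foldl_cat.
  by split=> [Xw|/ZE Zw]; [apply/ZE; exists w, y|apply: (quotX y)].
exists Q, (foldl d q0 x), d, F => w; rewrite -foldl_cat.
by split=> [Yw|/ZE Zw]; [apply/ZE; exists x, w|apply: (quotY x)].
Qed.

Lemma lconcat_sub X X' Y Y' :
  lsub X X' -> lsub Y Y' -> lsub (lconcat X Y) (lconcat X' Y').
Proof. by move=> XX YY _ [x [y [/XX Xx [/YY Yy ->]]]]; exists x, y. Qed.

Lemma lnonempty_sub X X' : lsub X X' -> lnonempty X -> lnonempty X'.
Proof. by move=> XX [x /XX]; exists x. Qed.

Lemma strong_alt_inducedE Z : strong_alt_induced Z ->
  exists X Y, strong_alt_code X Y /\ Z = lconcat X Y.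
Proof.
by move=> [X [Y [XY ZE]]]; exists X, Y; split=> //; apply: funext => w; apply/propext.
Qed.

Lemma strong_alt_induced_lconcat X Y :
  strong_alt_code X Y -> strong_alt_induced (lconcat X Y).
Proof. by move=> XY; exists X, Y. Qed.

Lemma left_complete_maximal X :
  suffix_code X -> right_complete (revl X) -> maximal_suffix_code X.
Proof.
move=> sX cX; split=> // Y sY XY y Yy.
have [||_ /(_ (revl Y))] := @right_complete_maximal _ (revl X) => //.
  exact/prefix_code_revl.
by rewrite -[y]revK; apply=> [|w /XY//|]; [apply/prefix_code_revl|rewrite /revl revK].
Qed.

Lemma right_complete_revl_lconcat X Y :
  right_complete (revl X) -> right_complete (revl Y) ->
  right_complete (revl (lconcat X Y)).
Proof.
move=> cX cY w; have [z [x [t [Zx e]]]] := right_complete_lconcat cY cX w.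
by exists z, x, t; split=> //; apply/revl_lconcat.
Qed.
End Alternation.

(** * Completion of regular strong alt-induced codes *)

Theorem mainTheorem5 (A : finType) (hA : 0 < #|A|) :
  (forall Z : lang A, regular Z -> strong_alt_induced Z -> prefix_code Z ->
     exists M : lang A, regular M /\ lsub Z M /\
       strong_alt_induced M /\ maximal_prefix_code M) /\
  (forall Z : lang A, regular Z -> strong_alt_induced Z -> suffix_code Z ->
     exists M : lang A, regular M /\ lsub Z M /\
       strong_alt_induced M /\ maximal_suffix_code M) /\
  (forall Z : lang A, regular Z -> strong_alt_induced Z -> bifix_code Z ->
     exists M : lang A, regular M /\ lsub Z M /\
       strong_alt_induced M /\ maximal_bifix_code M).
Proof.
have factors Z : regular Z -> strong_alt_induced Z -> exists X Y : lang A,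
    [/\ Z = lconcat X Y, regular X /\ regular Y, lnonempty X /\ lnonempty Y,
        prefix_code X /\ suffix_code Y &
        (prefix_code Z -> prefix_code Y) /\ (suffix_code Z -> suffix_code X)].
  move=> rZ /strong_alt_inducedE[X [Y [XY ZE]]]; exists X, Y; rewrite ZE in rZ *.
  have rXY := regular_factors XY rZ.
  have [pX sY] := (strong_alt_prefix XY, strong_alt_suffix XY).
  have [[neX [neY [X0 [Y0 _]]]] _] := XY.
  by split=> //; split; [apply: lconcat_prefix_r|apply: lconcat_suffix_l].
split; [|split] => Z rZ /(factors _ rZ)[X [Y [-> [rX rY] [neX neY] [pX sY] [pZ sZ]]]].
- move=> /pZ pY.
  have [X' [XX rX' pX' cX']] := prefix_completion rX pX neX.
  have [Y' [YY rY' [pY' sY'] cY']] := bifix_completion rY (conj pY sY) neY.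
  exists (lconcat X' Y'); split; first exact: regular_lconcat.
  split; first exact: lconcat_sub.
  split.
    apply/strong_alt_induced_lconcat/strong_altI => //; last by left.
      exact: lnonempty_sub neX.
    exact: lnonempty_sub neY.
  apply: right_complete_maximal; first exact: prefix_code_lconcat.
  exact: right_complete_lconcat.
- move=> /sZ sX.
  have revl_ne (V : lang A) : lnonempty V -> lnonempty (revl V).
    by move=> [v Vv]; exists (rev v); rewrite /revl revK.
  have revl_sub (V W : lang A) : lsub (revl V) W -> lsub V (revl W).
    by move=> VW v Vv; apply: VW; rewrite /revl revK.
  have revlK (V : lang A) : revl (revl V) = V.
    by apply: funext => w; rewrite /revl revK.
  (* Reversal swaps the two factors: now [revl Y] gets the prefix completion and [revl X] the bifix
     one. *)
  have [Y' [YY rY' pY' cY']] := prefix_completion (regular_revl rY)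
    (proj2 (prefix_code_revl Y) sY) (revl_ne _ neY).
  have [X' [XX rX' bX' cX']] := bifix_completion (regular_revl rX)
    (bifix_code_revl (conj pX sX)) (revl_ne _ neX).
  have [pX' sX'] := bifix_code_revl bX'.
  have sY' : suffix_code (revl Y') by apply/suffix_code_revl.
  exists (lconcat (revl X') (revl Y')).
  split; first by apply: regular_lconcat; apply: regular_revl.
  split; first by apply: lconcat_sub; apply: revl_sub.
  split.
    apply/strong_alt_induced_lconcat/strong_altI => //; last by right.
      exact: lnonempty_sub (revl_sub _ _ XX) neX.
    exact: lnonempty_sub (revl_sub _ _ YY) neY.
  apply: left_complete_maximal; first exact: suffix_code_lconcat.
  by apply: right_complete_revl_lconcat; rewrite revlK.
- move=> [/pZ pY /sZ sX].
  have [X' [XX rX' [pX' sX'] cX']] := bifix_completion rX (conj pX sX) neX.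
  have [Y' [YY rY' [pY' sY'] cY']] := bifix_completion rY (conj pY sY) neY.
  exists (lconcat X' Y'); split; first exact: regular_lconcat.
  split; first exact: lconcat_sub.
  split.
    apply/strong_alt_induced_lconcat/strong_altI => //; last by left.
      exact: lnonempty_sub neX.
    exact: lnonempty_sub neY.
  have pM := prefix_code_lconcat pX' pY'.
  split; first by split; last exact: suffix_code_lconcat.
  (* Bifix codes are prefix codes, so maximality among prefix codes suffices. *)
  move=> W [pW _]; apply: (proj2 (right_complete_maximal pM _)) => //.
  exact: right_complete_lconcat.
Qed.
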